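(* Let $a,b\in R^{WD\dagger}$ be both idempotent and Hermitian, let $a^{WD}$, $b^{WD}$ be WD inverses of $a$ and $b$, and let $a^{WD\dagger}=a^{WD}aa^\dagger$, $b^{WD\dagger}=b^{WD}bb^\dagger$ be the associated WDMP inverses. If $ab=ba$ and $b^{WD}ba=ab^{WD}b$, then $ab$ is WDMP invertible and $a^{WD\dagger}b^{WD\dagger}$ is a WDMP inverse of $ab$, i.e. $(ab)^{WD\dagger}=a^{WD\dagger}b^{WD\dagger}$.
   Context: $R$ is a proper unital ring with involution: an associative ring with $1$ and a map $*:R\to R$ with $(a+b)^*=a^*+b^*$, $(ab)^*=b^*a^*$, $(a^* )^*=a$, such that $a^*a=0$ implies $a=0$. An element $a$ is Hermitian if $a^*=a$ and idempotent if $a^2=a$. Moore-Penrose inverse: $a^\dagger$ is the unique $x$ (if it exists) with $axa=a$, $xax=x$, $(ax)^*=ax$, $(xa)^*=xa$; $R^\dagger$ is the set of Moore-Penrose invertible elements. Weak Drazin (WD) inverse: $a\in R$ is WD invertible if there are $x\in R$ and a positive integer $k$ with $axa=a$, $a^{k+1}x=a^k$, $xa^{k+1}=a^k$. The least positive integer $k$ for which such an $x$ exists is the weak Drazin index $\mathrm{ind}(a)$; any $x$ satisfying the three equations with $k=\mathrm{ind}(a)$ is a WD inverse of $a$ (not unique in general), denoted $a^{WD}$. $R^{WD}$ is the set of WD invertible elements. WDMP inverse: for $a\in R^{WD}\cap R^\dagger$, an element $y\in R$ is a WDMP inverse of $a$ if, for some WD inverse $a^{WD}$ of $a$ and $k=\mathrm{ind}(a)$,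 $yay=y$, $ay=aa^\dagger$, $ya^k=a^{WD}a^k$. $R^{WD\dagger}$ is the set of elements of $R^{WD}\cap R^\dagger$ having a WDMP inverse. For each WD inverse $a^{WD}$, the element $a^{WD}aa^\dagger$ is a WDMP inverse of $a$. *)

(* Defs.v *)
From mathcomp Require Import all_boot ssralg.

Set Implicit Arguments.
Unset Strict Implicit.
Unset Printing Implicit Defensive.

Import GRing.Theory.
Local Open Scope ring_scope.

(* [pzRingType] is the class of associative unital rings, 1 = 0 being allowed. *)
Record proper_involution (R : pzRingType) (star : R -> R) : Prop :=
  ProperInvolution {
    starD : forall a b, star (a + b) = star a + star b;
    starM : forall a b, star (a * b) = star b * star a;
    starK : forall a, star (star a) = a;
    star_proper : forall a, star a * a = 0 -> a = 0
  }.

Definition hermitian_elt (R : pzRingType) (star : R -> R) (a : R) : Prop :=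
  star a = a.

Definition idempotent_elt (R : pzRingType) (a : R) : Prop := a ^+ 2 = a.

(* Such an x is unique when it exists, so a^dagger is rendered as any x
   satisfying this predicate. *)
Definition is_MP (R : pzRingType) (star : R -> R) (a x : R) : Prop :=
  [/\ a * x * a = a,
      x * a * x = x,
      star (a * x) = a * x &
      star (x * a) = x * a].

Definition MP_invertible (R : pzRingType) (star : R -> R) (a : R) : Prop :=
  exists x, is_MP star a x.

Definition WD_equations (R : pzRingType) (a : R) (k : nat) (x : R) : Prop :=
  [/\ a * x * a = a,
      a ^+ k.+1 * x = a ^+ k &
      x * a ^+ k.+1 = a ^+ k].

Definition WD_invertible (R : pzRingType) (a : R) : Prop :=
  exists x k, (0 < k)%N /\ WD_equations a k x.

Definition is_WD_index (R : pzRingType) (a : R) (k : nat) : Prop :=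
  [/\ (0 < k)%N,
      exists x, WD_equations a k x &
      forall j, (0 < j)%N -> (exists x, WD_equations a j x) -> (k <= j)%N].

Definition is_WD (R : pzRingType) (a x : R) : Prop :=
  exists2 k, is_WD_index a k & WD_equations a k x.

Definition is_WDMP (R : pzRingType) (star : R -> R) (a y : R) : Prop :=
  exists awd adag k,
    [/\ is_WD a awd, is_MP star a adag & is_WD_index a k] /\
    [/\ y * a * y = y,
        a * y = a * adag &
        y * a ^+ k = awd * a ^+ k].

Definition WDMP_invertible (R : pzRingType) (star : R -> R) (a : R) : Prop :=
  [/\ WD_invertible a, MP_invertible star a & exists y, is_WDMP star a y].

(* Main.v *)
(* A Hermitian idempotent is its own WD inverse, of index 1, and its own
   Moore-Penrose inverse, hence its own WDMP inverse. At index 1 every WD inverse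
   x of an idempotent e satisfies x e = e, so both WDMP inverses in the product
   collapse to a and b, and a b is again a Hermitian idempotent. *)

Require Import Defs.
From mathcomp Require Import all_boot ssralg.

Set Implicit Arguments.
Unset Strict Implicit.
Unset Printing Implicit Defensive.

Import GRing.Theory.
Local Open Scope ring_scope.

Lemma idempotent_WD_equations (R : pzRingType) (e : R) :
  idempotent_elt e -> WD_equations e 1 e.
Proof. by rewrite /idempotent_elt expr2 => ee; split; rewrite ?expr2 ?expr1 !ee. Qed.

Lemma idempotent_WD_index (R : pzRingType) (e : R) :
  idempotent_elt e -> is_WD_index e 1.
Proof. by move=> ee; split=> //; exists e; apply: idempotent_WD_equations. Qed.

(** Since [e] solves the equations at exponent 1, minimality forces the index to be 1, the least
    value allowed. The third equation is then [x * e ^+ 2 = e ^+ 1]. *)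
Lemma idempotent_WD_mulr (R : pzRingType) (e x : R) :
  idempotent_elt e -> is_WD e x -> x * e = e.
Proof.
move=> ee [k [k_gt0 _ k_min] eqs].
have k1 : k = 1%N.
  apply/eqP; rewrite eqn_leq k_gt0 andbT; apply: k_min => //.
  by exists e; apply: idempotent_WD_equations.
by case: eqs; rewrite k1 ee expr1.
Qed.

Lemma hermitian_idempotent_MP (R : pzRingType) (star : R -> R) (e : R) :
  idempotent_elt e -> hermitian_elt star e -> is_MP star e e.
Proof. by rewrite /idempotent_elt expr2 => ee he; split; rewrite !ee. Qed.

(** As [e * d] and [e] are Hermitian, [e * d = star d * e], which absorbs a further [e] on the
    right; hence [e * d = e * d * e = e]. *)
Lemma hermitian_idempotent_MP_mull (R : pzRingType) (star : R -> R)
    (e d : R) :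
  proper_involution star -> idempotent_elt e -> hermitian_elt star e ->
  is_MP star e d -> e * d = e.
Proof.
rewrite /idempotent_elt expr2 => inv ee he [ede _ hed _].
have ed : e * d = star d * e by rewrite -hed (starM inv) he.
by rewrite -[RHS]ede ed -mulrA ee.
Qed.

Lemma hermitian_idempotent_is_WDMP (R : pzRingType) (star : R -> R) (e : R) :
  idempotent_elt e -> hermitian_elt star e -> is_WDMP star e e.
Proof.
move=> ee he; have ind1 := idempotent_WD_index ee.
(* With [e] in all three roles, the last two WDMP equations are trivial; only [e * e * e = e]
   remains. *)
exists e, e, 1%N; split; split=> //.
- by exists 1%N => //; apply: idempotent_WD_equations.
- exact: hermitian_idempotent_MP.
- by case: (idempotent_WD_equations ee).
Qed.

Lemma hermitian_idempotent_WDMP_collapse (R : pzRingType) (star : R -> R)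
    (e x d : R) :
  proper_involution star -> idempotent_elt e -> hermitian_elt star e ->
  is_WD e x -> is_MP star e d -> x * e * d = e.
Proof.
move=> inv ee he xe de.
by rewrite (idempotent_WD_mulr ee xe) (hermitian_idempotent_MP_mull inv ee he de).
Qed.

Theorem theorem3p13 (R : pzRingType) (star : R -> R)
    (star_inv : proper_involution star)
    (a b awd bwd adag bdag : R)
    (a_wdmp : WDMP_invertible star a) (b_wdmp : WDMP_invertible star b)
    (a_idem : idempotent_elt a) (b_idem : idempotent_elt b)
    (a_herm : hermitian_elt star a) (b_herm : hermitian_elt star b)
    (a_wd : is_WD a awd) (b_wd : is_WD b bwd)
    (a_mp : is_MP star a adag) (b_mp : is_MP star b bdag)
    (ab_comm : a * b = b * a)
    (ab_wd : bwd * b * a = a * bwd * b) :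
  WDMP_invertible star (a * b) /\
  is_WDMP star (a * b) ((awd * a * adag) * (bwd * b * bdag)).
Proof.
(* Whatever inverses were chosen, the candidate reduces to [a * b]. *)
rewrite (hermitian_idempotent_WDMP_collapse star_inv a_idem a_herm a_wd a_mp).
rewrite (hermitian_idempotent_WDMP_collapse star_inv b_idem b_herm b_wd b_mp).
(* Commutation gives both closure facts: it splits the square of [a * b], and it undoes the reversal
   of factors by [star]. *)
have ab_idem : idempotent_elt (a * b).
  by rewrite /idempotent_elt exprMn_comm // a_idem b_idem.
have ab_herm : hermitian_elt star (a * b).
  by rewrite /hermitian_elt (starM star_inv) a_herm b_herm.
have ab_self := hermitian_idempotent_is_WDMP ab_idem ab_herm.
split=> //; split; last by exists (a * b).
- by exists (a * b), 1%N; split=> //; apply: idempotent_WD_equations.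
- by exists (a * b); apply: hermitian_idempotent_MP.
Qed.
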